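(* Let $n\ge 2$ and let $m,a_1,\dots,a_n$ be nonnegative integers. Define $$I_m(a_1,\dots,a_n):=\frac{(-1)^m}{m!}\int_{(0,1)^n}\frac{\log^m\left(\prod_{i=1}^n x_i\right)\prod_{i=1}^n x_i^{a_i}}{1-\prod_{i=1}^n x_i}\,dx_1\cdots dx_n .$$ Let $c_1<\dots<c_r$ be the distinct values among $a_1,\dots,a_n$, and let $b_i\ge 1$ be the number of indices $k$ with $a_k=c_i$, so that $b_1+\dots+b_r=n$. Let $\mu_{ij}$ ($1\le i\le r$, $1\le j\le b_i$) be the coefficients of the partial fraction decomposition $$\prod_{i=1}^r\frac{1}{(c_i+x)^{b_i}}=\sum_{i=1}^r\sum_{j=1}^{b_i}\frac{\mu_{ij}}{(c_i+x)^j}.$$ Then: (i) if $r=1$, $$I_m(a_1,\dots,a_n)=\binom{m+n-1}{m}\zeta(n+m,c_1+1);$$ (ii) if $1<r\le n$, $$I_m(a_1,\dots,a_n)=\sum_{i=1}^{r-1}\mu_{i1}\bigl(H_{m+1}(c_r)-H_{m+1}(c_i)\bigr)+\sum_{i=1}^r\sum_{j=2}^{b_i}\binom{m+j-1}{m}\mu_{ij}\,\zeta(j+m,c_i+1).$$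
   Context: $H_s(x)=\sum_{k=1}^{\lfloor x\rfloor}k^{-s}$ is the generalized harmonic number (equal to $0$ for $x=0$). $\zeta(s,a)=\sum_{k=0}^\infty (k+a)^{-s}$ is the Hurwitz zeta function. An empty sum is $0$. *)

(* Defs.v *)
From HB Require Import structures.
From mathcomp Require Import all_boot all_order all_algebra.
From mathcomp Require Import all_classical all_reals all_analysis.
Set Implicit Arguments.
Unset Strict Implicit.
Unset Printing Implicit Defensive.
Import Order.TTheory GRing.Theory Num.Theory.
Import numFieldNormedType.Exports.
Local Open Scope classical_set_scope.
Local Open Scope ring_scope.

Definition cons_pair (T : Type) (n : nat) (p : T * n.-tuple T) : n.+1.-tuple T :=
  [tuple of p.1 :: p.2].

(* n-dimensional Lebesgue measure on R^n, the latter being represented by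
   [n.-tuple (measurableTypeR R)] with its product sigma-algebra: the n-fold
   product measure, transported along R * R^n -> R^(n+1).
   See [lebesgue_measure_tuple_box]. *)
Fixpoint lebesgue_measure_tuple (R : realType) (n : nat) :
    set (n.-tuple (measurableTypeR R)) -> \bar R :=
  match n with
  | 0 => dirac [tuple]
  | n'.+1 => pushforward
      (product_measure1 lebesgue_measure (@lebesgue_measure_tuple R n'))
      (@cons_pair (measurableTypeR R) n')
  end.
Arguments lebesgue_measure_tuple {R n}.

Section lebesgue_measure_tuple_measure.
Variable R : realType.
Local Notation T := (measurableTypeR R).

Lemma measurable_cons_pair n : measurable_fun setT (@cons_pair T n).
Proof.
exact: (@measurable_cons _ _ (T * n.-tuple T)%type T fst n snd).
Qed.

Section step.
Variables (n : nat) (mu : {sigma_finite_measure set (n.-tuple T) -> \bar R}).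

Let p : set (T * n.-tuple T) -> \bar R := product_measure1 lebesgue_measure mu.

Let q : set (n.+1.-tuple T) -> \bar R := pushforward p (@cons_pair T n).

Let Q : {measure set (n.+1.-tuple T) -> \bar R} :=
  measure_function_pushforward__canonical__measure_function_Measure
    (product_measure1 (@lebesgue_measure R) mu) (@measurable_cons_pair n).

HB.instance Definition _ := isMeasure.Build _ _ _ q
  (measure0 Q) (measure_ge0 Q) (@measure_semi_sigma_additive _ _ _ Q).

Let q_sigma_finite : sigma_finite setT q.
Proof.
have /sigma_finiteP[F [TF ndF Foo]] :=
  sigma_finiteT (@lebesgue_measure R : {sigma_finite_measure set T -> \bar R}).
have /sigma_finiteP[G [TG ndG Goo]] := sigma_finiteT mu.
pose u (t : n.+1.-tuple T) := (thead t, [tuple of behead t]).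
have meas_u : measurable_fun setT u.
  apply/measurable_fun_pairP; split.
    exact: (@measurable_tnth _ T n.+1 ord0).
  exact: measurable_behead.
exists (fun i => u @^-1` (F i `*` G i)).
  rewrite -preimage_bigcup (_ : \bigcup_i _ = setT) ?preimage_setT//.
  apply/seteqP; split => // -[x y] _.
  have : [set: T] x by []. rewrite TF => -[i _ Fx].
  have : [set: n.-tuple T] y by []. rewrite TG => -[j _ Gy].
  exists (maxn i j) => //; split => /=.
    by move: x Fx; exact/subsetPset/ndF/leq_maxl.
  by move: y Gy; exact/subsetPset/ndG/leq_maxr.
move=> i; have [mFi Fi] := Foo i; have [mGi Gi] := Goo i; split.
  rewrite -[X in measurable X]setTI; apply: meas_u => //; exact: measurableX.
rewrite /q /pushforward (_ : _ @^-1` _ = F i `*` G i)//.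
  by rewrite /p product_measure1E// lte_mul_pinfty// ge0_fin_numE.
rewrite -comp_preimage (_ : u \o _ = id)//; apply/funext => -[x t] /=.
by congr pair; apply/val_inj.
Qed.

HB.instance Definition _ := Measure_isSigmaFinite.Build _ _ _ q q_sigma_finite.

Definition lebesgue_measure_tuple_succ :
  {sigma_finite_measure set (n.+1.-tuple T) -> \bar R} := q.

End step.

Lemma lebesgue_measure_tuple_sigma_finite_measure n :
  {mu : {sigma_finite_measure set (n.-tuple T) -> \bar R} |
    mu = lebesgue_measure_tuple :> (set (n.-tuple T) -> \bar R)}.
Proof.
elim: n => [|n [mu muE]]; first by exists (dirac [tuple]).
by exists (lebesgue_measure_tuple_succ mu) => /=; rewrite -muE.
Qed.

Let sfm n := projT1 (lebesgue_measure_tuple_sigma_finite_measure n).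

Let sfmE n : (sfm n : set _ -> \bar R) = lebesgue_measure_tuple.
Proof. exact: projT2 (lebesgue_measure_tuple_sigma_finite_measure n). Qed.

Section instances.
Variable n : nat.
Local Notation lam := (@lebesgue_measure_tuple R n).

Let lam0 : lam set0 = 0%E.
Proof. by rewrite -sfmE measure0. Qed.

Let lam_ge0 A : (0 <= lam A)%E.
Proof. by rewrite -sfmE measure_ge0. Qed.

Let lam_sigma_additive : semi_sigma_additive lam.
Proof. by rewrite -sfmE; exact: measure_semi_sigma_additive. Qed.

HB.instance Definition _ := isMeasure.Build _ _ _ lam
  lam0 lam_ge0 lam_sigma_additive.

Let lam_sigma_finite : sigma_finite setT lam.
Proof. by rewrite -sfmE; exact: sigma_finiteT. Qed.

HB.instance Definition _ := Measure_isSigmaFinite.Build _ _ _ lam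
  lam_sigma_finite.

End instances.

Lemma lebesgue_measure_tuple_box n (A : 'I_n -> set T) :
  (forall i, measurable (A i)) ->
  lebesgue_measure_tuple [set x | forall i, A i (tnth x i)] =
  (\prod_(i < n) lebesgue_measure (A i))%E.
Proof.
elim: n A => [|n IH] A mA.
  by rewrite big_ord0 /= diracE mem_set// => -[].
have mB : measurable [set x : n.-tuple T | forall i, A (lift ord0 i) (tnth x i)].
  rewrite (_ : [set x | _] =
      \bigcap_(i in [set: 'I_n]) ((@tnth _ T)^~ i @^-1` A (lift ord0 i))).
    apply: fin_bigcap_measurable => // i _.
    by rewrite -[X in measurable X]setTI; exact: (measurable_tnth i).
  by apply/seteqP; split => x /= h i => [_|]; exact: h.
rewrite big_ord_recl -IH//= /pushforward.
rewrite (_ : _ @^-1` _ = A ord0 `*`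
    [set x : n.-tuple T | forall i, A (lift ord0 i) (tnth x i)]).
  exact: product_measure1E.
apply/seteqP; split => -[x t] /=.
  move=> h; split; first by have := h ord0.
  by move=> i; have := h (lift ord0 i); rewrite /cons_pair tnthS.
move=> [h0 h] i; case: (unliftP ord0 i) => [j ->|->]; last exact: h0.
by rewrite /cons_pair tnthS.
Qed.

End lebesgue_measure_tuple_measure.

(* The value is an extended real.  On the open cube [ln (\prod x_i) < 0] and
   [0 < 1 - \prod x_i], so the integrand has constant sign: the integral is
   always meaningful, and it is finite iff it converges absolutely. *)
Definition I_integral (R : realType) (m n : nat) (a : 'I_n -> nat) : \bar R :=
  (((-1) ^+ m / m`!%:R)%:E *
   \int[lebesgue_measure_tuple]_(x in
       [set x : n.-tuple (measurableTypeR R) |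
         forall i, (0 < (tnth x i : R) < 1)%R])
     (ln (\prod_(i < n) (tnth x i : R)) ^+ m *
      \prod_(i < n) (tnth x i : R) ^+ a i /
      (1 - \prod_(i < n) (tnth x i : R)))%:E)%E.
Arguments I_integral : clear implicits.

(* [Num.truncn x] is the floor of [x] for [0 <= x], and [0] (hence an empty
   sum) for [x < 0]. *)
Definition harmonic_number (R : realType) (s : nat) (x : R) : R :=
  \sum_(1 <= k < (Num.truncn x).+1) k%:R ^- s.

(* Natural exponents only; the series converges for [2 <= s] and [0 < a]. *)
Definition hurwitz_zeta (R : realType) (s : nat) (a : R) : R :=
  limn (series (fun k : nat => (k%:R + a) ^- s)).

Definition distinct_values (n : nat) (a : 'I_n -> nat) : seq nat :=
  sort leq (undup [seq a k | k : 'I_n]).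

Definition multiplicity (n : nat) (a : 'I_n -> nat) (v : nat) : nat :=
  #|[pred k : 'I_n | a k == v]|.

(* Main.v *)
Require Import Defs.
From mathcomp Require Import all_boot all_order all_algebra.
From mathcomp Require Import all_classical all_reals all_analysis.
From mathcomp Require Import measurable_realfun ring.
Set Implicit Arguments.
Unset Strict Implicit.
Unset Printing Implicit Defensive.
Import Order.TTheory GRing.Theory Num.Theory.
Import numFieldNormedType.Exports.
Local Open Scope classical_set_scope.
Local Open Scope ring_scope.

(** On the open cube put P = \prod_i x_i, so that 0 < P < 1.  Expanding
    1 / (1 - P) as a geometric series and integrating term by term (everything
    has a constant sign) turns the integral into
      \sum_(k >= 0) F_m (k + 1),
    where m! * F_m y is the integral over the cube of
    (- ln P) ^ m * \prod_i x_i ^ (a_i + y - 1) ([I_integral_series]).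

    The logarithm of a product is a sum of logarithms, so by the binomial
    theorem and Tonelli the n-fold integral is a Cauchy product of
    one-dimensional ones, and the integral of (- ln x) ^ j / j! * x ^ s over
    ]0, 1[ is (s + 1) ^- (j + 1).  Hence F_m is the polynomial [recip_homog] in
    the inverses of the a_i + y ([integral_log_kernel]).

    To compare F_m with the partial fractions, note that both families satisfy
    F_m' = - (m + 1) F_(m + 1) on the positive reals: both are
    (- 1) ^ m / m! times the m-th derivative of their member of index 0.  Two
    such families that agree for m = 0 agree for every m ([derive_chain_eq]),
    and for m = 0 the equality is the given partial fraction decomposition.
    Therefore
      F_m y = \sum_i \sum_j 'C(m + j - 1, m) mu_ij / (c_i + y) ^ (j + m).

    It remains to sum over y = 1, 2, and so on.  The terms with j >= 2 give
    Hurwitz zeta values.  The terms with j = 1 may diverge one by one when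
    m = 0, but since n >= 2 the residues mu_i1 add up to 0 ([sum_residues]), so
    the last one can be eliminated, and the differences that appear sum to
    differences of harmonic numbers ([cvg_series_harmonic_number]). *)

(** * Integrals of powers of the logarithm on the unit interval *)

Section log_monomial.
Context {R : realType}.
Implicit Types (x y : R) (m n s : nat).

Lemma is_derive_mul (f g : R -> R) x df dg :
  is_derive x 1 f df -> is_derive x 1 g dg ->
  is_derive x 1 (fun y => f y * g y) (df * g x + f x * dg).
Proof.
move=> hf hg; apply: (is_derive_eq (is_deriveM hf hg)).
by rewrite /GRing.scale/= addrC mulrC.
Qed.

Lemma is_derive_mulr_cst (f : R -> R) (k : R) x df : is_derive x 1 f df ->
  is_derive x 1 (fun y => f y * k) (df * k).
Proof.
move=> hf; have := is_derive_mul hf (is_derive_cst k x 1).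
by rewrite /= mulr0 addr0.
Qed.

Lemma is_derive_exp (f : R -> R) n x df : is_derive x 1 f df ->
  is_derive x 1 (fun y => f y ^+ n) (n%:R * f x ^+ n.-1 * df).
Proof.
move=> hf; have := is_deriveX n hf.
by rewrite (_ : f ^+ n = fun y => f y ^+ n)//; apply/funext => y; rewrite exprfctE.
Qed.

Definition log_monomial m s x : R := (- ln x) ^+ m / m`!%:R * x ^+ s.

(** Integrating [log_monomial m s] by parts, differentiating the power of the
    logarithm, lowers [m] by one; this recursion collects the boundary terms. *)
Fixpoint log_primitive m s x : R :=
  (log_monomial m s.+1 x +
    if m is m'.+1 then log_primitive m' s x else 0) / s.+1%:R.

Lemma is_derive_log_monomial m s x : 0 < x ->
  is_derive x 1 (log_monomial m s.+1)
    (s.+1%:R * log_monomial m s x -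
     (if m is m'.+1 then log_monomial m' s x else 0)).
Proof.
move=> x0.
have dN : is_derive x 1 (fun y => - ln y : R) (- x^-1).
  exact: is_deriveN (is_derive1_ln x0).
have dm := is_derive_mulr_cst m`!%:R^-1 (is_derive_exp m dN).
have ds := is_derive_exp s.+1 (is_derive_id x 1).
apply: (is_derive_eq (is_derive_mul dm ds)).
rewrite /log_monomial /= mulr1 exprS.
case: m {dm} => [|m]; first by rewrite !mul0r subr0 add0r mulrCA.
rewrite factS natrM invfM /=.
have fm0 : m`!%:R != 0 :> R by rewrite pnatr_eq0 -lt0n fact_gt0.
field.
by rewrite fm0 !gt_eqF.
Qed.

Lemma is_derive_log_primitive m s x : 0 < x ->
  is_derive x 1 (log_primitive m s) (log_monomial m s x).
Proof.
move=> x0; elim: m => [|m IH] /=.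
  have d := is_derive_log_monomial 0 s x0.
  have := is_derive_mulr_cst s.+1%:R^-1 (is_deriveD d (is_derive_cst 0 x 1)).
  move=> /is_derive_eq; apply.
  by rewrite addr0 subr0 mulrAC mulfV ?mul1r ?pnatr_eq0.
have d := is_derive_log_monomial m.+1 s x0.
apply: (is_derive_eq (is_derive_mulr_cst s.+1%:R^-1 (is_deriveD d IH))).
by rewrite subrK mulrAC mulfV ?mul1r ?pnatr_eq0.
Qed.

Lemma log_primitive1 m s : log_primitive m s 1 = s.+1%:R ^- m.+1.
Proof.
elim: m => [|m IH] /=.
  by rewrite /log_monomial expr0 fact0 expr1n addr0 !divr1 !mul1r expr1.
by rewrite IH /log_monomial ln1 oppr0 expr0n/= !mul0r add0r -invfM -exprSr.
Qed.

(** The points exp (- (n + 1)) tend to 0 and turn the logarithm into n + 1; the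
    term m + 1 of the exponential series then bounds the power of n + 1. *)
Lemma log_monomial_expRN_cvg0 m s :
  log_monomial m s.+1 (expR (- n.+1%:R)) @[n --> \oo] --> (0 : R).
Proof.
apply: (@squeeze_cvgr _ _ _ _ (fun=> 0) (fun n => m.+1%:R * n.+1%:R^-1)); last 2 first.
- exact: cvg_cst.
- rewrite -[X in _ --> X](mulr0 m.+1%:R); apply: cvgMr; exact: cvg_harmonic.
near=> n; rewrite /log_monomial expRK opprK.
have e0 : 0 < expR (- n.+1%:R) :> R by exact: expR_gt0.
apply/andP; split.
  by rewrite !mulr_ge0// ?exprn_ge0// ltW.
rewrite exprS mulrA.
have e1 : expR (- n.+1%:R) ^+ s <= 1 :> R.
  by rewrite exprn_ile1// ?ltW// -expR0 ltr_expR oppr_lt0.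
apply: (@le_trans _ _ (n.+1%:R ^+ m / m`!%:R * expR (- n.+1%:R))).
  rewrite ler_piMr// !mulr_ge0// ?exprn_ge0// ltW//.
rewrite expRN ler_pdivrMr ?expR_gt0//.
have /(le_trans _) := (@expR_ge1Dxn R n.+1%:R m (ler0n _ _)).
move=> /(_ (n.+1%:R ^+ m.+1 / m.+1`!%:R)).
rewrite lerDr => /(_ ler01) h.
apply: (le_trans _ (ler_wpM2l _ h)); last by rewrite mulr_ge0.
rewrite factS natrM exprS le_eqVlt; apply/orP; left; apply/eqP.
have fm0 : m`!%:R != 0 :> R by rewrite pnatr_eq0 -lt0n fact_gt0.
field.
by rewrite fm0 !gt_eqF// ltr_pwDl.
Unshelve. all: by end_near. Qed.

Lemma log_primitive_expRN_cvg0 m s :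
  log_primitive m s (expR (- n.+1%:R)) @[n --> \oo] --> (0 : R).
Proof.
elim: m => [|m IH] /=; rewrite -[X in _ --> X](mul0r s.+1%:R^-1);
  apply: cvgMl; rewrite -[X in _ --> X](addr0 0); apply: cvgD;
  by [exact: log_monomial_expRN_cvg0|exact: cvg_cst|].
Qed.

Lemma log_monomial_ge0 m s x : 0 < x <= 1 -> 0 <= log_monomial m s x.
Proof.
move=> /andP[x0 x1]; rewrite !mulr_ge0// ?exprn_ge0// ?(ltW x0)//.
by rewrite oppr_ge0 ln_le0.
Qed.

Lemma measurable_log_monomial m s (D : set (measurableTypeR R)) :
  measurable_fun D (log_monomial m s : measurableTypeR R -> R).
Proof.
apply: (measurable_funS measurableT) => //.
apply: measurable_funM; last by apply: measurable_funX; exact: measurable_id.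
apply: measurable_funM => //; apply: measurable_funX.
by apply: measurableT_comp => //; exact: measurable_ln.
Qed.

Lemma integral_log_monomial_itvcc m s e : 0 < e < 1 ->
  (\int[lebesgue_measure]_(x in `[e, 1%R]) (log_monomial m s x)%:E =
  (log_primitive m s 1)%:E - (log_primitive m s e)%:E)%E.
Proof.
move=> /andP[e0 e1].
have dF x : 0 < x -> derivable (log_primitive m s) x 1.
  by move=> x0; case: (is_derive_log_primitive m s x0).
have cF x : 0 < x -> {for x, continuous (log_primitive m s)}.
  by move=> x0; apply: differentiable_continuous; apply/derivable1_diffP; exact: dF.
apply: continuous_FTC2 => //.
- apply: continuous_in_subspaceT => x; rewrite inE/= in_itv/= => /andP[ex _].
  have x0 := lt_le_trans e0 ex.
  apply: cvgM; last exact: exprn_continuous.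
  apply: cvgMl; apply: (@continuous_comp R R R (fun y => - ln y) (fun z => z ^+ m)).
    exact/continuousN/continuous_ln.
  exact: exprn_continuous.
- split.
  + by move=> x /[!in_itv]/= /andP[ex _]; apply/dF/(lt_trans e0).
  + by apply: cvg_at_right_filter; exact: cF.
  + by apply: cvg_at_left_filter; exact: cF.
- move=> x /[!in_itv]/= /andP[ex _].
  rewrite derive1E; apply: derive_val.
  exact/is_derive_log_primitive/(lt_trans e0).
Qed.

Lemma bigcup_itv_expRN :
  \bigcup_n `[expR (- n.+1%:R), 1%R]%classic = `]0, 1%R]%classic :> set R.
Proof.
apply/seteqP; split => x /=.
  move=> [n _ /=]; rewrite !in_itv/= => /andP[+ ->]; rewrite andbT.
  by apply: lt_le_trans; exact: expR_gt0.
rewrite in_itv/= => /andP[x0 x1].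
exists (Num.truncn (- ln x)) => //=; rewrite in_itv/= x1 andbT.
rewrite -[leRHS](@lnK R)// ler_expR lerNl.
by apply/ltW/truncnS_gt.
Qed.

(** The integrand may be unbounded at 0: the fundamental theorem of calculus is
    applied on [exp (- (n + 1)), 1], and these intervals exhaust ]0, 1]. *)
Lemma integral_log_monomial m s :
  (\int[lebesgue_measure]_(x in `]0%R, 1%R[) (log_monomial m s x)%:E =
  (s.+1%:R ^- m.+1)%:E)%E.
Proof.
rewrite integral_itv_bndo_bndc; last first.
  by apply/measurable_EFinP; exact: measurable_log_monomial.
rewrite -bigcup_itv_expRN.
have ndF : nondecreasing_seq (fun n => `[expR (- n.+1%:R), 1%R]%classic : set R).
  move=> p q pq; rewrite subsetEset => x /=; rewrite !in_itv/= => /andP[px ->].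
  by rewrite andbT (le_trans _ px)// ler_expR lerN2 ler_nat.
have := @ge0_nondecreasing_set_cvg_integral _ (measurableTypeR R) R _
  (fun x => (log_monomial m s x)%:E) lebesgue_measure ndF.
have mF (i : nat) :
  measurable (`[expR (- i.+1%:R), 1%R]%classic : set (measurableTypeR R)) by [].
have mf (i : nat) : measurable_fun
    (`[expR (- i.+1%:R), 1%R]%classic : set (measurableTypeR R))
    (fun x => (log_monomial m s x)%:E).
  by apply/measurable_EFinP; exact: measurable_log_monomial.
move=> /(_ mF mf) H.
have f0 (i : nat) x : `[expR (- i.+1%:R), 1%R]%classic x ->
    (0 <= (log_monomial m s x)%:E)%E.
  rewrite /= in_itv/= lee_fin => /andP[ix x1]; apply: log_monomial_ge0.
  by rewrite x1 andbT (lt_le_trans _ ix)// expR_gt0.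
move: H => /(_ f0) /cvg_lim <- //.
apply/cvg_lim => //.
have e01 n : 0 < expR (- n.+1%:R : R) < 1.
  by rewrite expR_gt0 -[ltRHS]expR0 ltr_expR oppr_lt0 ltr0Sn.
under eq_fun do rewrite (integral_log_monomial_itvcc _ _ (e01 _)) log_primitive1.
apply: cvg_EFin; first by apply: nearW.
rewrite -[X in _ --> X]subr0; apply: cvgB; first exact: cvg_cst.
exact: log_primitive_expRN_cvg0.
Qed.

End log_monomial.

(** * Iterated integration over the unit cube *)

Section cube.
Context {R : realType}.
Local Notation T := (measurableTypeR R).

Definition open_cube n : set (n.-tuple T) :=
  [set x | forall i, 0 < (tnth x i : R) < 1].
Arguments open_cube : clear implicits.

Lemma measurable_open_cube n : measurable (open_cube n).
Proof.
rewrite (_ : open_cube n =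
    \bigcap_(i in [set: 'I_n]) ((@tnth _ T)^~ i @^-1` `]0, 1[%classic)).
  apply: fin_bigcap_measurable => // i _.
  by rewrite -[X in measurable X]setTI; apply: (measurable_tnth i).
apply/seteqP; split => x /= h i; first by move=> _; rewrite /= in_itv/=; exact: h.
by have := h i I; rewrite /= in_itv.
Qed.

Lemma open_cube_cons n x0 (t : n.-tuple T) :
  open_cube n.+1 (cons_pair (x0, t)) <-> 0 < (x0 : R) < 1 /\ open_cube n t.
Proof.
split=> [h|[h0 ht] i].
  by split=> [|i]; [exact: (h ord0)|have := h (lift ord0 i); rewrite /cons_pair tnthS].
by case: (unliftP ord0 i) => [j ->|-> //]; rewrite /cons_pair tnthS; exact: ht.
Qed.

Local Open Scope ereal_scope.

(** Tonelli, the measure in dimension n + 1 being a product measure transported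
    along [cons_pair]. *)
Lemma integral_tuple_cons n (f : n.+1.-tuple T -> \bar R) :
  measurable_fun setT f -> (forall x, 0 <= f x) ->
  \int[lebesgue_measure_tuple]_x f x =
  \int[lebesgue_measure]_(x in [set: T])
    \int[lebesgue_measure_tuple]_(t in [set: n.-tuple T]) f (cons_pair (x, t)).
Proof.
move=> mf f0.
pose nu : {measure set (T * n.-tuple T) -> \bar R} :=
  (@lebesgue_measure R \x @lebesgue_measure_tuple R n).
rewrite (eq_measure_integral (pushforward nu (@cons_pair T n)))//.
rewrite ge0_integral_pushforward//; last exact: measurable_cons_pair.
rewrite preimage_setT fubini_tonelli1//; last by move=> x; exact: f0.
exact: (measurableT_comp mf (@measurable_cons_pair R n)).
Qed.

Lemma integral_open_cube_cons n (f : n.+1.-tuple T -> \bar R) :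
  measurable_fun (open_cube n.+1) f ->
  (forall x, open_cube n.+1 x -> 0 <= f x) ->
  \int[lebesgue_measure_tuple]_(x in open_cube n.+1) f x =
  \int[lebesgue_measure]_(x in `]0%R, 1%R[%classic : set T)
    \int[lebesgue_measure_tuple]_(t in open_cube n) f (cons_pair (x, t)).
Proof.
move=> mf f0.
have mC := measurable_open_cube.
rewrite integral_mkcond integral_tuple_cons; last 2 first.
- by apply/(measurable_restrictT _ (mC _)).
- by move=> x; apply: erestrict_ge0.
rewrite [RHS]integral_mkcond; apply: eq_integral => x _.
rewrite patchE; case: ifPn => [|]; rewrite ?inE ?notin_setE /= in_itv/= => x01.
  rewrite [RHS]integral_mkcond; apply: eq_integral => t _.
  rewrite !patchE (_ : (cons_pair _ \in _) = (t \in open_cube n))//.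
  apply/idP/idP; rewrite !inE => ht; first by have /open_cube_cons[] := ht.
  exact/open_cube_cons.
apply: integral0_eq => t _; rewrite patchE ifN// notin_setE.
by move=> /open_cube_cons[].
Qed.

End cube.
Arguments open_cube {R} n _.

(** * Powers of the logarithm of the product of the coordinates *)

Section log_kernel.
Context {R : realType}.
Local Notation T := (measurableTypeR R).

Definition log_kernel m n (s : 'I_n -> nat) (x : n.-tuple T) : R :=
  (- ln (\prod_(i < n) (tnth x i : R))) ^+ m / m`!%:R *
  \prod_(i < n) (tnth x i : R) ^+ s i.

(** This is h_m(1/u_1, .., 1/u_n) / (u_1 * .. * u_n), where h_m is the complete
    homogeneous symmetric polynomial of degree m.  The recursion follows the
    integration over the first coordinate. *)
Fixpoint recip_homog (u : seq R) m : R :=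
  if u is v :: u' then \sum_(j < m.+1) v ^- j.+1 * recip_homog u' (m - j)%N
  else (m == 0%N)%:R.

Lemma prod_tnth_gt0 n (x : n.-tuple T) : open_cube n x ->
  0 < \prod_(i < n) (tnth x i : R).
Proof. by move=> hx; apply: prodr_gt0 => i _; have /andP[] := hx i. Qed.

Lemma prod_tnth_le1 n (x : n.-tuple T) : open_cube n x ->
  \prod_(i < n) (tnth x i : R) <= 1.
Proof.
by move=> hx; apply: prodr_ile1 => i _; have /andP[? ?] := hx i; rewrite !ltW.
Qed.

Lemma log_kernel_ge0 m n s (x : n.-tuple T) : open_cube n x -> 0 <= log_kernel m s x.
Proof.
move=> hx; rewrite !mulr_ge0// ?exprn_ge0//.
  by rewrite oppr_ge0 ln_le0// prod_tnth_le1.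
by apply: prodr_ge0 => i _; have /andP[? ?] := hx i; rewrite exprn_ge0// ltW.
Qed.

Lemma measurable_prod_tnth n (e : 'I_n -> nat) (D : set (n.-tuple T)) :
  measurable_fun D (fun x => \prod_(i < n) (tnth x i : R) ^+ e i).
Proof.
apply: (measurable_funS measurableT) => //; apply: measurable_prod => i _.
by apply: measurable_funX; exact: (measurable_tnth i).
Qed.

Lemma measurable_log_kernel m n s (D : set (n.-tuple T)) :
  measurable_fun D (log_kernel m s).
Proof.
apply: (measurable_funS measurableT) => //.
apply: measurable_funM; last exact: measurable_prod_tnth.
apply: measurable_funM => //; apply: measurable_funX.
apply: measurableT_comp => //; apply: measurableT_comp; first exact: measurable_ln.
exact: (@measurable_prod_tnth n (fun=> 1%N)).
Qed.

(** The logarithm of the product splits off its first coordinate, and the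
    binomial theorem becomes a Cauchy product once the powers are divided by
    factorials. *)
Lemma log_kernel_cons m n (s : 'I_n.+1 -> nat) x0 (t : n.-tuple T) :
  0 < (x0 : R) < 1 -> open_cube n t ->
  log_kernel m s (cons_pair (x0, t)) =
  \sum_(j < m.+1) log_monomial j (s ord0) (x0 : R) *
    log_kernel (m - j)%N (s \o lift ord0) t.
Proof.
move=> /andP[x00 x01] ht.
have prodE (e : 'I_n.+1 -> nat) :
    \prod_(i < n.+1) (tnth (cons_pair (x0, t)) i : R) ^+ e i =
    x0 ^+ e ord0 * \prod_(i < n) (tnth t i : R) ^+ e (lift ord0 i).
  rewrite big_ord_recl; congr (_ * _).
  by apply: eq_bigr => i _; rewrite /cons_pair tnthS.
rewrite /log_kernel prodE (prodE (fun=> 1%N)) expr1.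
under [in LHS]eq_bigr do rewrite expr1.
rewrite lnM ?posrE ?prod_tnth_gt0// opprD addrC exprDn !mulr_suml.
apply: eq_bigr => -[j /=]; rewrite ltnS => jm _.
rewrite /log_monomial -mulr_natr -(bin_fact jm) !natrM.
have f0 k : k`!%:R != 0 :> R by rewrite pnatr_eq0 -lt0n fact_gt0.
have b0 : 'C(m, j)%:R != 0 :> R by rewrite pnatr_eq0 -lt0n bin_gt0.
field.
by rewrite !f0 b0.
Qed.

Lemma integral_log_kernel m n (s : 'I_n -> nat) :
  (\int[lebesgue_measure_tuple]_(x in open_cube n) (log_kernel m s x)%:E =
   (recip_homog [seq (s i).+1%:R | i <- enum 'I_n] m)%:E)%E.
Proof.
elim: n m s => [|n IH] m s.
  rewrite (eq_measure_integral (dirac [tuple]))// integral_dirac//; last 2 first.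
  - exact: measurable_open_cube.
  - by apply/measurable_EFinP; exact: measurable_log_kernel.
  rewrite diracE mem_set ?mul1e; last by move=> -[].
  rewrite /log_kernel !big_ord0 ln1 oppr0 mulr1 enum_ord0/= expr0n.
  by case: m => [|m] /=; rewrite ?mul0r// fact0 divr1.
rewrite integral_open_cube_cons; last 2 first.
- by apply/measurable_EFinP; exact: measurable_log_kernel.
- by move=> x hx; rewrite lee_fin log_kernel_ge0.
have mC := @measurable_open_cube R n.
transitivity (\int[lebesgue_measure]_(x in `]0%R, 1%R[%classic : set T)
  \sum_(j < m.+1) ((log_monomial j (s ord0) x)%:E *
   (recip_homog [seq ((s \o lift ord0) i).+1%:R | i <- enum 'I_n] (m - j)%N)%:E))%E.
  apply: eq_integral => x; rewrite inE/= in_itv/= => x01.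
  have x01' : 0 < x <= 1 by case/andP: x01 => -> /ltW.
  under eq_integral => t /[!inE] ht.
    rewrite log_kernel_cons// -sumEFin.
    over.
  rewrite ge0_integral_sum//=; last 2 first.
  - move=> j; apply/measurable_EFinP; apply: measurable_funM => //.
    exact: measurable_log_kernel.
  - by move=> j t ht; rewrite lee_fin mulr_ge0 ?log_kernel_ge0 ?log_monomial_ge0.
  apply: eq_bigr => j _; under eq_integral do rewrite EFinM.
  rewrite ge0_integralZl_EFin//.
  - by rewrite IH.
  - by move=> t ht; rewrite lee_fin log_kernel_ge0.
  - by apply/measurable_EFinP; exact: measurable_log_kernel.
  - exact: log_monomial_ge0.
have r0 j : 0 <= recip_homog [seq ((s \o lift ord0) i).+1%:R | i <- enum 'I_n] j.
  rewrite -lee_fin -IH; apply: integral_ge0 => t ht.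
  by rewrite lee_fin log_kernel_ge0.
have l0 j x : `]0%R, 1%R[%classic x -> 0 <= log_monomial j (s ord0) x.
  by rewrite /= in_itv/= => /andP[x0 /ltW x1]; rewrite log_monomial_ge0// x0.
rewrite ge0_integral_sum//=; last 2 first.
- move=> j; apply: emeasurable_funM => //.
  by apply/measurable_EFinP; exact: measurable_log_monomial.
- by move=> j x hx; rewrite mule_ge0// lee_fin ?l0.
rewrite enum_ordSl /= -sumEFin; apply: eq_bigr => j _.
rewrite ge0_integralZr//=.
- by rewrite integral_log_monomial -map_comp.
- by apply/measurable_EFinP; exact: measurable_log_monomial.
- by move=> x hx; rewrite lee_fin l0.
- by rewrite lee_fin.
Qed.

End log_kernel.

(** * Expansion in a geometric series *)

Section geometric.
Context {R : realType}.
Local Notation T := (measurableTypeR R).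

Lemma nneseries_cvgE (u : R ^nat) (l : R) :
  series u @ \oo --> l -> (\sum_(0 <= k <oo) (u k)%:E = l%:E)%E.
Proof.
move=> ul; apply/cvg_lim => //.
under eq_fun do rewrite sumEFin.
by apply: cvg_EFin; [exact: nearW|exact: ul].
Qed.

Lemma prod_tnth_lt1 n (x : n.-tuple T) : (0 < n)%N -> open_cube n x ->
  \prod_(i < n) (tnth x i : R) < 1.
Proof.
case: n x => // n x _ hx; rewrite big_ord_recl.
have /andP[x0 x1] := hx ord0.
apply: le_lt_trans x1; rewrite ler_piMr ?(ltW x0)//.
by apply: prodr_ile1 => i _; have /andP[? ?] := hx (lift ord0 i); rewrite !ltW.
Qed.

(** Raising every exponent by k multiplies the kernel by the k-th power of the
    product of the coordinates. *)
Lemma log_kernel_geometric m n (a : 'I_n -> nat) (x : n.-tuple T) :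
  (0 < n)%N -> open_cube n x ->
  (\sum_(0 <= k <oo) (log_kernel m (fun i => a i + k)%N x)%:E =
  (log_kernel m a x / (1 - \prod_(i < n) (tnth x i : R)))%:E)%E.
Proof.
move=> n0 hx; have P0 := prod_tnth_gt0 hx; have P1 := prod_tnth_lt1 n0 hx.
apply: nneseries_cvgE.
rewrite (_ : (fun k => _) = geometric (log_kernel m a x) (\prod_(i < n) (tnth x i : R))).
  by apply: cvg_geometric_series; rewrite ger0_norm ?ltW.
apply/funext => k /=; rewrite /log_kernel -[RHS]mulrA -prodrXl -big_split/=.
by congr (_ * _); apply: eq_bigr => i _; rewrite exprD.
Qed.

Lemma I_integral_series m n (a : 'I_n -> nat) : (0 < n)%N ->
  (I_integral R m n a = \sum_(0 <= k <oo)
    (recip_homog [seq (a i)%:R + k.+1%:R | i <- enum 'I_n] m : R)%:E)%E.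
Proof.
move=> n0; rewrite /I_integral.
have mC := @measurable_open_cube R n.
pose G (x : n.-tuple T) : \bar R :=
  (log_kernel m a x / (1 - \prod_(i < n) (tnth x i : R)))%:E.
have G0 x : open_cube n x -> (0 <= G x)%E.
  move=> hx; rewrite lee_fin mulr_ge0 ?log_kernel_ge0// invr_ge0 subr_ge0.
  exact: prod_tnth_le1.
have GE x : open_cube n x ->
    G x = (\sum_(0 <= k <oo) (log_kernel m (fun i => a i + k)%N x)%:E)%E.
  by move=> hx; rewrite log_kernel_geometric.
have -> : (\sum_(0 <= k <oo)
    (recip_homog [seq (a i)%:R + k.+1%:R | i <- enum 'I_n] m : R)%:E =
    \int[lebesgue_measure_tuple]_(x in open_cube n) G x)%E.
  under [RHS]eq_integral => x /[!inE] hx do rewrite GE//.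
  rewrite integral_nneseries//=; last 2 first.
  - by move=> k; apply/measurable_EFinP; exact: measurable_log_kernel.
  - by move=> k x hx; rewrite lee_fin log_kernel_ge0.
  apply: eq_eseriesr => k _; rewrite integral_log_kernel.
  by congr (recip_homog _ _)%:E; apply: eq_map => i; rewrite -natrD addnS.
have mG : measurable_fun (open_cube n) G.
  apply: (eq_measurable_fun (fun x =>
      \sum_(0 <= k <oo) (log_kernel m (fun i => a i + k)%N x)%:E)%E).
    by move=> x /[!inE] hx; rewrite GE.
  apply: ge0_emeasurable_sum.
  - by move=> k x hx _; rewrite lee_fin log_kernel_ge0.
  - by move=> k _; apply/measurable_EFinP; exact: measurable_log_kernel.
have f0 : m`!%:R != 0 :> R by rewrite pnatr_eq0 -lt0n fact_gt0.
have mG' : measurable_fun (open_cube n) (fun x => m`!%:R%:E * G x)%E.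
  exact: measurable_funeM.
have G0' x : open_cube n x -> (0 <= m`!%:R%:E * G x)%E.
  by move=> hx; rewrite mule_ge0 ?G0// lee_fin.
transitivity (((-1) ^+ m / m`!%:R)%:E *
  \int[lebesgue_measure_tuple]_(x in open_cube n)
    (((-1) ^+ m)%:E * (m`!%:R%:E * G x)))%E.
  congr (_ * _)%E; apply: eq_integral => x _.
  rewrite -!EFinM; congr EFin.
  rewrite /log_kernel (exprNn (ln _)).
  have [->|P1] := eqVneq (\prod_(i < n) (tnth x i : R)) 1.
    by rewrite subrr invr0 !mulr0.
  have P1' : 1 - \prod_(i < n) (tnth x i : R) != 0 by rewrite subr_eq0 eq_sym.
  rewrite -[LHS]mul1r -{1}(sqrr_sign R m) expr2.
  by field; rewrite f0 P1'.
have -> : (\int[lebesgue_measure_tuple]_(x in open_cube n)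
    (((-1) ^+ m)%:E * (m`!%:R%:E * G x)) =
    ((-1) ^+ m)%:E * \int[lebesgue_measure_tuple]_(x in open_cube n)
      (m`!%:R%:E * G x))%E.
  (* linearity without integrability: the integrand has a constant sign *)
  rewrite -signr_odd; case: (odd m); rewrite ?expr1 ?expr0; last first.
    by rewrite ge0_integralZl_EFin.
  by under eq_integral do rewrite EFinN mulN1e; rewrite integral_ge0N// EFinN mulN1e.
rewrite ge0_integralZl_EFin// !muleA -!EFinM.
rewrite (_ : _ * _ = 1) ?mul1e//.
by rewrite mulrAC divfK// -expr2 sqrr_sign.
Qed.

End geometric.

(** * Families of functions closed under differentiation *)

Section derive_chain.
Context {R : realType}.

(** Equivalently, G m is (- 1) ^ m / m! times the m-th derivative of G 0 on the
    positive reals.  This normalisation makes Leibniz's formula a plain Cauchy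
    product. *)
Definition derive_chain (G : nat -> R -> R) :=
  forall m (x : R), 0 < x -> is_derive x 1 (G m) (- (m.+1%:R * G m.+1 x)).

(** If G m and H m agree on the open set of positive reals, so do their
    derivatives, which are G (m + 1) and H (m + 1) up to a common nonzero
    factor. *)
Lemma derive_chain_eq G H : derive_chain G -> derive_chain H ->
  (forall x, 0 < x -> G 0%N x = H 0%N x) ->
  forall m x, 0 < x -> G m x = H m x.
Proof.
move=> cG cH GH0; elim=> [//|m IH] x x0.
have GH : \near x, G m x = H m x.
  by near=> y; apply: IH; near: y; exact: lt_nbhsr.
have := near_eq_derive (1 : R) GH.
rewrite (@derive_val _ _ _ _ _ _ _ (cG m x x0)) (@derive_val _ _ _ _ _ _ _ (cH m x x0)).
by move/oppr_inj/mulfI; apply; rewrite pnatr_eq0.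
Unshelve. all: by end_near. Qed.

Lemma is_derive_bigsum (I : Type) (r : seq I) (P : pred I)
    (f : I -> R -> R) (x : R) (df : I -> R) :
  (forall i, P i -> is_derive x 1 (f i) (df i)) ->
  is_derive x 1 (fun y => \sum_(i <- r | P i) f i y) (\sum_(i <- r | P i) df i).
Proof.
move=> h; rewrite -fct_sumE; elim/big_ind2: _ => //.
- exact: is_derive_cst.
- by move=> g dg k dk hg hk; exact: is_deriveD.
Qed.

Lemma derive_chain_sum p q (G : nat -> nat -> R -> R) :
  (forall i, (p <= i < q)%N -> derive_chain (G i)) ->
  derive_chain (fun m x => \sum_(p <= i < q) G i m x).
Proof.
move=> cG m x x0; rewrite mulr_sumr -sumrN big_nat_cond.
under eq_fun do rewrite big_nat_cond.
by apply: is_derive_bigsum => i; rewrite andbT => /cG; apply.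
Qed.

Lemma derive_chainZ k G : derive_chain G -> derive_chain (fun m x => k * G m x).
Proof.
move=> cG m x x0; have := is_derive_mulr_cst k (cG m x x0).
rewrite (_ : (fun y => G m y * k) = (fun y => k * G m y)); last first.
  by apply/funext => y; rewrite mulrC.
by move=> /is_derive_eq; apply; ring.
Qed.

(** The factor m + 1 splits as j + (m + 1 - j), which accounts for the two
    terms of the product rule. *)
Lemma derive_chainM G H : derive_chain G -> derive_chain H ->
  derive_chain (fun m x => \sum_(j < m.+1) G j x * H (m - j)%N x).
Proof.
move=> cG cH m x x0.
have d (j : 'I_m.+1) : is_derive x 1 (fun y => G j y * H (m - j)%N y)
    (- (j.+1%:R * G j.+1 x) * H (m - j)%N x +
     G j x * - ((m - j).+1%:R * H (m - j).+1 x)).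
  exact: is_derive_mul (cG _ _ x0) (cH _ _ x0).
have := @is_derive_bigsum _ (index_enum 'I_m.+1) xpredT _ x _ (fun j _ => d j).
move=> /is_derive_eq; apply.
have -> : m.+1%:R * (\sum_(j < m.+2) G j x * H (m.+1 - j)%N x) =
    \sum_(j < m.+2) j%:R * (G j x * H (m.+1 - j)%N x) +
    \sum_(j < m.+2) (m.+1 - j)%:R * (G j x * H (m.+1 - j)%N x).
  rewrite mulr_sumr -big_split/=; apply: eq_bigr => -[j /=]; rewrite ltnS => jm _.
  by rewrite -mulrDl -natrD subnKC.
(* the extreme terms of the two sums have coefficient 0 *)
rewrite [X in - (X + _)]big_ord_recl mul0r add0r.
rewrite [X in - (_ + X)]big_ord_recr /= subnn mul0r addr0.
rewrite -big_split -sumrN; apply: eq_bigr => -[j /=]; rewrite ltnS => jm _.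
by rewrite /bump/= add1n subSS subSn//; ring.
Qed.

Lemma is_derive_expV (c x : R) k : 0 <= c -> 0 < x ->
  is_derive x 1 (fun y => (c + y) ^- k) (- (k%:R * (c + x) ^- k.+1)).
Proof.
move=> c0 x0; have cx : c + x != 0 by rewrite gt_eqF// ltr_wpDl.
have dx := is_deriveD (is_derive_cst c x 1) (is_derive_id x 1).
have dX := is_derive_exp k dx.
have := is_deriveV (f := fun y => (c + y) ^+ k) _ dX.
move=> /(_ (expf_neq0 _ cx)) /is_derive_eq; apply.
rewrite /GRing.scale/= add0r mulr1.
case: k dX => [|k] _; first by rewrite !mul0r mulr0 oppr0.
rewrite /= !exprS; field.
by rewrite cx expf_neq0.
Qed.

(** The factors k, k + 1, .., k + m - 1 produced by m derivations of
    (c + x) ^ (- k), divided by m!, form the binomial coefficient. *)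
Lemma derive_chain_expV (c : R) k : 0 <= c -> (0 < k)%N ->
  derive_chain (fun m x => 'C(m + k - 1, m)%:R * (c + x) ^- (k + m)).
Proof.
case: k => // k c0 _ m x x0.
have := is_derive_mulr_cst ('C(m + k.+1 - 1, m)%:R) (is_derive_expV (k.+1 + m) c0 x0).
rewrite (_ : (fun y => _ * _) =
    (fun y => 'C(m + k.+1 - 1, m)%:R * (c + y) ^- (k.+1 + m))); last first.
  by apply/funext => y; rewrite mulrC.
move=> /is_derive_eq; apply.
rewrite !addnS !subn1/= mulrA -natrM addSn -mul_bin_diag natrM.
by rewrite (addnC k); ring.
Qed.

Lemma derive_chain_recip_homog (c : seq R) : all (fun a => 0 <= a) c ->
  derive_chain (fun m x => recip_homog [seq a + x | a <- c] m).
Proof.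
elim: c => [_|a c IH /= /andP[a0 c0]] m x x0 /=.
  by rewrite mulr0 oppr0; exact: is_derive_cst.
have ca : derive_chain (fun m x => (a + x) ^- m.+1).
  have := @derive_chain_expV a 1 a0 isT.
  rewrite (_ : (fun _ _ => _) = (fun m x => (a + x) ^- m.+1))//.
  by apply/funext => k; apply/funext => y; rewrite addn1 subn1 binn mul1r add1n.
exact: (derive_chainM ca (IH c0)).
Qed.

Lemma recip_homog0 (u : seq R) : recip_homog u 0 = \prod_(v <- u) v^-1.
Proof.
elim: u => [|v u IH] /=; first by rewrite big_nil.
by rewrite big_ord1 big_cons -IH expr1.
Qed.

End derive_chain.

(** * Hurwitz zeta values and harmonic numbers as sums of series *)

Section series.
Context {R : realType}.
Implicit Types (u v : R ^nat).

Lemma cvg_sum_nat p q (u : nat -> R ^nat) (l : nat -> R) :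
  (forall i, (p <= i < q)%N -> u i n @[n --> \oo] --> l i) ->
  \sum_(p <= i < q) u i n @[n --> \oo] --> \sum_(p <= i < q) l i.
Proof.
move=> ul; rewrite big_nat_cond; under eq_fun do rewrite big_nat_cond.
rewrite -fct_sumE; elim/big_ind2: _ => [|f a g b fa gb|i].
- exact: cvg_cst.
- exact: cvgD.
- by rewrite andbT => /ul.
Qed.

Lemma cvg_series_sum_nat p q (u : nat -> R ^nat) (l : nat -> R) :
  (forall i, (p <= i < q)%N -> series (u i) @ \oo --> l i) ->
  series (fun k => \sum_(p <= i < q) u i k) @ \oo --> \sum_(p <= i < q) l i.
Proof.
move=> ul; rewrite (_ : series _ = fun n => \sum_(p <= i < q) series (u i) n).
  exact: cvg_sum_nat.
by apply/funext => n; rewrite /series/= exchange_big.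
Qed.

Lemma cvg_seriesZ k u (l : R) : series u @ \oo --> l ->
  series (fun n => k * u n) @ \oo --> k * l.
Proof.
move=> ul; rewrite (_ : series _ = fun n => k * series u n); first exact: cvgMr.
by apply/funext => n; rewrite /series/= mulr_sumr.
Qed.

Lemma cvg_seriesD u v (l k : R) : series u @ \oo --> l -> series v @ \oo --> k ->
  series (fun n => u n + v n) @ \oo --> l + k.
Proof.
move=> ul vk; rewrite (_ : series _ = fun n => series u n + series v n).
  exact: cvgD.
by apply/funext => n; rewrite /series/= big_split.
Qed.

Lemma cvg_telescope u (l : R) : u @ \oo --> l ->
  series (fun n => u n - u n.+1) @ \oo --> u 0%N - l.
Proof.
move=> ul; rewrite (_ : series _ = fun n => u 0%N - u n).
  by apply: cvgB => //; exact: cvg_cst.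
apply/funext => n; rewrite /series/= -[RHS]opprB -telescope_sumr// -sumrN.
by apply: eq_bigr => i _; rewrite opprB.
Qed.

Lemma cvg_shift_expV (c : nat) s : (0 < s)%N ->
  (c%:R + k.+1%:R : R) ^- s @[k --> \oo] --> (0 : R).
Proof.
case: s => // s _.
apply: (@squeeze_cvgr _ _ _ _ (fun=> 0) (@harmonic R)); last 2 first.
- exact: cvg_cst.
- exact: cvg_harmonic.
near=> k; rewrite -natrD addnS invr_ge0 exprn_ge0//= /harmonic/=.
rewrite lef_pV2 ?posrE ?exprn_gt0//.
rewrite -natrX ler_nat (leq_trans _ (leq_pexp2l _ (_ : 1 <= s.+1)%N))//.
by rewrite expn1 ltnS leq_addl.
Unshelve. all: by end_near. Qed.

(** By induction on c: the sums for c + 1 and c differ by a telescoping series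
    with value (c + 1) ^ (- s).  Subtracting two instances compares any two
    shifts, which is how the divergence of the harmonic series is avoided. *)
Lemma cvg_series_harmonic_number s (c : nat) : (0 < s)%N ->
  series (fun k => k.+1%:R ^- s - (c%:R + k.+1%:R) ^- s) @ \oo -->
  harmonic_number s (c%:R : R).
Proof.
move=> s0; elim: c => [|c IH].
  rewrite /harmonic_number natrK big_geq//.
  rewrite (_ : (fun _ => _) = fun=> 0); last first.
    by apply/funext => k; rewrite add0r subrr.
  rewrite (_ : series _ = fun=> 0); first exact: cvg_cst.
  by apply/funext => k; rewrite /series/= big1.
have -> : harmonic_number s (c.+1%:R : R) = harmonic_number s (c%:R : R) + (c.+1%:R ^- s).
  by rewrite /harmonic_number !natrK big_nat_recr.
have := cvg_seriesD IH (cvg_telescope (@cvg_shift_expV c s s0)).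
rewrite subr0 -natrD addn1.
rewrite (_ : (fun _ => _) = (fun k => k.+1%:R ^- s - (c.+1%:R + k.+1%:R) ^- s))//.
apply/funext => k; rewrite addrA subrK; congr (_ - _ ^- _).
by rewrite -!natrD addnS.
Qed.

(** The comparison series is the telescoping one with general term
    2 / ((k + 1) (k + 2)). *)
Lemma cvg_hurwitz_zeta s (c : nat) : (2 <= s)%N ->
  series (fun k => (c%:R + k.+1%:R) ^- s) @ \oo --> hurwitz_zeta s (c%:R + 1 : R).
Proof.
move=> s2; rewrite /hurwitz_zeta.
rewrite (_ : (fun k : nat => (k%:R + _) ^- s) =
    (fun k => (c%:R + k.+1%:R : R) ^- s)); last first.
  by apply/funext => k; rewrite addrCA -natr1.
apply: (@series_le_cvg _ _
    (fun k => 2 * ((0%:R + k.+1%:R) ^- 1 - (0%:R + k.+2%:R) ^- 1))).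
- by move=> k; rewrite invr_ge0 exprn_ge0// addr_ge0.
- move=> k; rewrite mulr_ge0// !add0r !expr1 subr_ge0 lef_pV2 ?posrE//.
  by rewrite ler_nat.
- move=> k; rewrite !add0r !expr1.
  have k1 : k.+1%:R != 0 :> R by rewrite pnatr_eq0.
  have k2 : k.+2%:R != 0 :> R by rewrite pnatr_eq0.
  have -> : 2 * (k.+1%:R^-1 - k.+2%:R^-1) = 2 / (k.+1 * k.+2)%:R :> R.
    rewrite natrM; have -> : k.+2%:R = k.+1%:R + 1 :> R by rewrite natr1.
    by field; rewrite !gt_eqF// !ltr_wpDl.
  apply: (@le_trans _ _ (k.+1%:R ^- 2)).
    rewrite lef_pV2 ?posrE ?exprn_gt0 -?natrD ?ltr0n// -?natrX ?ler_nat.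
    rewrite (leq_trans (_ : _ <= k.+1 ^ s)%N)//; first exact: leq_pexp2l.
      by rewrite leq_exp2r ?leq_addl// (leq_trans _ s2).
    by rewrite addnS.
  rewrite ler_pdivlMr ?ltr0n ?muln_gt0// mulrC ler_pdivrMr ?exprn_gt0//.
  rewrite -natrX -natrM ler_nat -mulnn mulnCA leq_mul2l.
  by rewrite mul2n -addnn addSnnS leq_addl orbT.
- apply: cvgP; apply: cvg_seriesZ; exact: (cvg_telescope (@cvg_shift_expV 0 1 isT)).
Qed.

End series.

(** * Partial fractions *)

Section partial_fractions.
Context {R : realType}.

Lemma mem_distinct_values n (a : 'I_n -> nat) v :
  (v \in distinct_values a) = (v \in codom a).
Proof. by rewrite mem_sort mem_undup. Qed.

Lemma multiplicityE n (a : 'I_n -> nat) v :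
  multiplicity a v = count_mem v [seq a k | k : 'I_n].
Proof.
by rewrite /multiplicity cardE /enum_mem size_filter count_map -enumT.
Qed.

Lemma prod_distinct_values n (a : 'I_n -> nat) (f : nat -> R) :
  \prod_(0 <= i < size (distinct_values a))
    f (nth 0%N (distinct_values a) i) ^+
      multiplicity a (nth 0%N (distinct_values a) i) =
  \prod_(i < n) f (a i).
Proof.
rewrite -(big_nth 0%N xpredT (fun v => f v ^+ multiplicity a v)).
rewrite (perm_big (undup [seq a k | k : 'I_n])) ?perm_sort//=.
rewrite -[RHS]big_enum/= -[RHS](big_map a xpredT f).
rewrite -[RHS]big_undup_iterop_count/=; apply: eq_bigr => v _.
by rewrite multiplicityE.
Qed.

(** Only the case of index 0 has to be checked, where [recip_homog] is the
    product of the inverses. *)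
Lemma recip_homog_shift m n (a : 'I_n -> nat) (H : nat -> R -> R) :
  derive_chain H ->
  (forall x, 0 < x -> \prod_(i < n) ((a i)%:R + x)^-1 = H 0%N x) ->
  forall x, 0 < x -> recip_homog [seq (a i)%:R + x | i <- enum 'I_n] m = H m x.
Proof.
move=> cH H0 x x0.
have mapE y : [seq (a i)%:R + y | i <- enum 'I_n] =
    [seq c + y | c <- [seq (a i)%:R : R | i <- enum 'I_n]].
  exact: map_comp.
rewrite mapE; move: m x x0.
apply: (derive_chain_eq _ cH) => [|x x0].
  by apply: derive_chain_recip_homog; apply/allP => _ /mapP[i _ ->].
by rewrite -mapE recip_homog0 big_map big_enum/= H0.
Qed.

Lemma cvg_scaled_expV (c : nat) j :
  (k.+1%:R : R) * (c%:R + k.+1%:R) ^- j.+1 @[k --> \oo] --> ((j == 0%N)%:R : R).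
Proof.
have c1 : (k.+1%:R : R) * (c%:R + k.+1%:R) ^- 1 @[k --> \oo] --> (1 : R).
  rewrite (_ : (fun _ => _) = fun k => 1 - c%:R * (c%:R + k.+1%:R) ^- 1); last first.
    apply/funext => k; rewrite expr1.
    have k0 : c%:R + k.+1%:R != 0 :> R by rewrite -natrD addnS pnatr_eq0.
    by apply: (mulIf k0); rewrite mulfVK// mulrBl mulfVK// mul1r addrAC subrr add0r.
  rewrite -[X in _ --> X](subr0 1) -[X in _ --> _ - X](mulr0 c%:R).
  by apply: cvgB; [exact: cvg_cst|apply: cvgMr; exact: cvg_shift_expV].
case: j => [//|j].
rewrite (_ : (fun _ => _) =
    fun k => k.+1%:R * (c%:R + k.+1%:R) ^- 1 * (c%:R + k.+1%:R) ^- j.+1).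
  by rewrite -[X in _ --> X](mul1r 0); apply: cvgM => //; exact: cvg_shift_expV.
by apply/funext => k; rewrite -mulrA -invfM expr1 -exprS.
Qed.

Lemma cvg_scaled_prod n (a : 'I_n -> nat) : (2 <= n)%N ->
  (k.+1%:R : R) * \prod_(i < n) ((a i)%:R + k.+1%:R)^-1 @[k --> \oo] --> (0 : R).
Proof.
move=> n2.
apply: (@squeeze_cvgr _ _ _ _ (fun=> 0) (@harmonic R)); last 2 first.
- exact: cvg_cst.
- exact: cvg_harmonic.
near=> k; apply/andP; split.
  by rewrite mulr_ge0// prodr_ge0// => i _; rewrite invr_ge0 addr_ge0.
rewrite /harmonic/= mulrC -ler_pdivlMr// -invfM -expr2.
apply: (@le_trans _ _ (\prod_(i < n) k.+1%:R^-1)).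
  apply: ler_prod => i _; rewrite invr_ge0 addr_ge0//=.
  by rewrite lef_pV2 ?posrE -?natrD ?ler_nat ?ltr0n ?addnS// ltnS leq_addl.
rewrite prodr_const card_ord exprVn lef_pV2 ?posrE ?exprn_gt0//.
by rewrite -!natrX ler_nat leq_pexp2l.
Unshelve. all: by end_near. Qed.

(** Multiply the decomposition by x and let x tend to infinity: the left-hand
    side is O(1/x) since it has at least two factors, and on the right the terms
    with j = 1 alone survive. *)
Lemma sum_residues n (a : 'I_n -> nat) r (c b : nat -> nat) (mu : nat -> nat -> R) :
  (2 <= n)%N -> (forall i, (i < r)%N -> (0 < b i)%N) ->
  (forall x : R, 0 < x -> \prod_(i < n) ((a i)%:R + x)^-1 =
    \sum_(0 <= i < r) \sum_(1 <= j < (b i).+1) mu i j / ((c i)%:R + x) ^+ j) ->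
  \sum_(0 <= i < r) mu i 1%N = 0.
Proof.
move=> n2 b0 pf.
have := cvg_scaled_prod a n2.
under eq_fun do rewrite pf//.
have : \sum_(0 <= i < r) \sum_(1 <= j < (b i).+1)
      mu i j * (k.+1%:R * ((c i)%:R + k.+1%:R) ^- j.-1.+1) @[k --> \oo] -->
    \sum_(0 <= i < r) \sum_(1 <= j < (b i).+1) mu i j * (j.-1 == 0%N)%:R.
  apply: cvg_sum_nat => i _; apply: cvg_sum_nat => j _; apply: cvgMr.
  exact: cvg_scaled_expV.
rewrite (_ : (fun _ => _) = fun k : nat => k.+1%:R *
    \sum_(0 <= i < r) \sum_(1 <= j < (b i).+1) mu i j / ((c i)%:R + k.+1%:R) ^+ j).
  move=> h1 h2; rewrite -[RHS](cvg_unique _ h1 h2)//; apply: eq_big_nat => i /andP[_ ir].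
  rewrite big_ltn ?ltnS ?b0//= mulr1 big_nat big1 ?addr0// => j /andP[j1 _].
  by case: j j1 => [|[|j]]//= _; rewrite mulr0.
apply/funext => k; rewrite mulr_sumr; apply: eq_bigr => i _.
rewrite mulr_sumr; apply: eq_big_nat => j /andP[j1 _].
by rewrite prednK// mulrCA.
Qed.

End partial_fractions.

Unset Implicit Arguments.
Set Strict Implicit.
Set Printing Implicit Defensive.

Theorem theorem2 (R : realType) (n m : nat) (a : 'I_n -> nat)
    (c : seq nat) (r : nat) (b : nat -> nat) (mu : nat -> nat -> R)
    (hn : (2 <= n)%N)
    (hc : c = distinct_values a)
    (hr : r = size c)
    (hb : forall i : nat, (i < r)%N -> b i = multiplicity a (nth 0%N c i))
    (hmu : forall x : R,
      (forall i : nat, (i < r)%N -> (nth 0%N c i)%:R + x != 0) ->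
      \prod_(0 <= i < r) (((nth 0%N c i)%:R + x) ^+ b i)^-1 =
      \sum_(0 <= i < r) \sum_(1 <= j < (b i).+1)
        mu i j / ((nth 0%N c i)%:R + x) ^+ j) :
  (r = 1%N ->
    I_integral R m n a =
    ('C(m + n - 1, m)%:R *
     hurwitz_zeta (n + m) ((nth 0%N c 0)%:R + 1 : R))%:E) /\
  ((1 < r <= n)%N ->
    I_integral R m n a =
    (\sum_(0 <= i < r.-1) mu i 1%N *
       (harmonic_number m.+1 ((nth 0%N c r.-1)%:R : R) -
        harmonic_number m.+1 ((nth 0%N c i)%:R : R)) +
     \sum_(0 <= i < r) \sum_(2 <= j < (b i).+1)
       'C(m + j - 1, m)%:R * mu i j *
       hurwitz_zeta (j + m) ((nth 0%N c i)%:R + 1 : R))%:E).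
Proof.
have n0 : (0 < n)%N by apply: leq_trans hn.
have mem_c i : a i \in c by rewrite hc mem_distinct_values codom_f.
have chainV (v j : nat) : (0 < j)%N -> derive_chain (fun p (x : R) =>
    'C(p + j - 1, p)%:R * (v%:R + x) ^- (j + p)).
  by move=> j0; exact: derive_chain_expV.
have zetaV (v j : nat) : (2 <= j)%N ->
    series (fun k => 'C(m + j - 1, m)%:R * (v%:R + k.+1%:R) ^- (j + m)) @ \oo -->
    'C(m + j - 1, m)%:R * hurwitz_zeta (j + m) (v%:R + 1 : R).
  by move=> j2; apply/cvg_seriesZ/cvg_hurwitz_zeta; rewrite (leq_trans j2)// leq_addr.
rewrite I_integral_series//; split=> [r1|/andP[r1 _]].
  have aE i : a i = nth 0%N c 0.
    move: (mem_c i) hr; rewrite r1.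
    by case: (c) => [//|v [|//]] /=; rewrite inE => /eqP.
  apply: nneseries_cvgE.
  rewrite (_ : (fun k => _) = fun k : nat =>
      'C(m + n - 1, m)%:R * ((nth 0%N c 0)%:R + k.+1%:R) ^- (n + m)).
    exact: zetaV.
  apply/funext => k.
  rewrite (@recip_homog_shift R m n a _ (chainV (nth 0%N c 0) n n0))// => x x0.
  rewrite bin0 mul1r addn0.
  by under eq_bigr do rewrite aE; rewrite prodr_const card_ord exprVn.
have pf x : 0 < x -> \prod_(i < n) ((a i)%:R + x)^-1 =
    \sum_(0 <= i < r) \sum_(1 <= j < (b i).+1)
      mu i j / ((nth 0%N c i)%:R + x) ^+ j.
  move=> x0; rewrite -hmu; last by move=> i _; rewrite gt_eqF// ltr_wpDl.
  rewrite -(prod_distinct_values a (fun v => (v%:R + x)^-1)) -hc -hr.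
  by apply: eq_big_nat => i /andP[_ ir]; rewrite hb// exprVn.
have b0 i : (i < r)%N -> (0 < b i)%N.
  move=> ir; rewrite hb// multiplicityE -has_count has_pred1.
  by rewrite -mem_undup -(mem_sort leq) -/(distinct_values a) -hc mem_nth -?hr.
have res0 := sum_residues hn b0 pf.
pose p (v k : nat) : R := (v%:R + k.+1%:R) ^- m.+1.
have termE k : recip_homog [seq (a i)%:R + k.+1%:R | i <- enum 'I_n] m =
    \sum_(0 <= i < r.-1) mu i 1%N *
      (p (nth 0%N c i) k - p (nth 0%N c r.-1) k) +
    \sum_(0 <= i < r) \sum_(2 <= j < (b i).+1)
      mu i j * ('C(m + j - 1, m)%:R *
        ((nth 0%N c i)%:R + k.+1%:R) ^- (j + m)).
  have cH : derive_chain (fun q (x : R) =>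
      \sum_(0 <= i < r) \sum_(1 <= j < (b i).+1)
        mu i j * ('C(q + j - 1, q)%:R * ((nth 0%N c i)%:R + x) ^- (j + q))).
    apply: derive_chain_sum => i _; apply: derive_chain_sum => j /andP[j1 _].
    by apply: derive_chainZ; exact: chainV.
  rewrite (@recip_homog_shift R m n a _ cH)//; last first.
    move=> x x0; rewrite pf//; apply: eq_bigr => i _; apply: eq_bigr => j _.
    by rewrite bin0 mul1r addn0.
  transitivity (\sum_(0 <= i < r) (mu i 1%N * p (nth 0%N c i) k +
      \sum_(2 <= j < (b i).+1) mu i j * ('C(m + j - 1, m)%:R *
        ((nth 0%N c i)%:R + k.+1%:R) ^- (j + m)))).
    apply: eq_big_nat => i /andP[_ ir]; rewrite big_ltn ?ltnS ?b0//.
    by rewrite addnK binn mul1r.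
  rewrite big_split/=; congr (_ + _).
  (* the residues add up to 0, which eliminates the last of them *)
  move: res0; rewrite -(prednK (ltnW r1)) !big_nat_recr//= => /eqP.
  rewrite addrC addr_eq0 => /eqP ->.
  rewrite mulNr mulr_suml -sumrB; apply: eq_bigr => i _.
  by rewrite mulrBr.
apply: nneseries_cvgE; under eq_fun do rewrite termE.
apply: cvg_seriesD; apply: cvg_series_sum_nat => i _.
  apply: cvg_seriesZ.
  have := cvg_seriesD (@cvg_series_harmonic_number R m.+1 (nth 0%N c r.-1) isT)
    (cvg_seriesZ (k := -1) (@cvg_series_harmonic_number R m.+1 (nth 0%N c i) isT)).
  rewrite mulN1r (_ : (fun _ => _) =
    fun k => p (nth 0%N c i) k - p (nth 0%N c r.-1) k)//.
  by apply/funext => k; rewrite /p; ring.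
apply: cvg_series_sum_nat => j /andP[j2 _].
rewrite (mulrC _ (mu i j)) -mulrA.
exact/cvg_seriesZ/zetaV.
Qed.
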